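(* Let $w=[x^\top,y^\top,z^\top]^\top$ be the unique solution of the double saddle point problem $\mathfrak{B}w=b$, let $L\in\mathbb{R}^{k\times l}$, take $\tau=\gamma=2$, and assume that $\Psi$, $\chi$ and $\xi_L$ are positive real numbers. Then $$\mathfrak{K}^{(2)}_{\varphi}(\mathbf{H},b;L)\le\mathfrak{K}^{(2),u}_{\varphi}(\mathbf{H},b;L):=\frac{\|L\mathfrak{B}^{-1}\|_2}{\xi_L}\left(\Psi\|\mathcal{J}\|_2^{1/2}+\chi\right),$$ where $$\mathcal{J}=\begin{bmatrix} (\|x\|_2^2+\|y\|_2^2)I_n & xy^\top & 0 \\ yx^\top & (\|x\|_2^2+\|y\|_2^2+\|z\|_2^2)I_m & yz^\top \\ 0 & zy^\top & (\|y\|_2^2+\|z\|_2^2)I_p \end{bmatrix}\in\mathbb{R}^{l\times l}.$$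
   Context: Let $A\in\mathbb{R}^{n\times n}$, $B\in\mathbb{R}^{m\times n}$, $C\in\mathbb{R}^{p\times m}$, $D\in\mathbb{R}^{m\times m}$, $E\in\mathbb{R}^{p\times p}$, $l=n+m+p$, $b\in\mathbb{R}^{l}$, and $$\mathfrak{B}=\begin{bmatrix} A & B^\top & 0 \\ B & -D & C^\top \\ 0 & C & E \end{bmatrix},$$ which is assumed nonsingular throughout. The double saddle point problem (DSPP) is $\mathfrak{B}w=b$ with $w=[x^\top,y^\top,z^\top]^\top$, $x\in\mathbb R^n$, $y\in\mathbb R^m$, $z\in\mathbb R^p$. $\mathrm{vec}$ stacks the columns of a matrix; for a tuple, $\mathrm{vec}(X_1,\dots,X_r)=[\mathrm{vec}(X_1)^\top,\dots,\mathrm{vec}(X_r)^\top]^\top$. $\|\cdot\|_2$ is the Euclidean norm for vectors and the spectral norm for matrices. Write $\mathbf{H}=(A,B,C,D,E)$. For $L\in\mathbb{R}^{k\times l}$ ($k\le l$) put $\varphi(\mathbf{H},b)=L\mathfrak{B}^{-1}b$. For positive real parameters $\Psi,\chi,\xi_L$ and $\tau=\gamma=2$, the partial condition number of $w$ with respect to $L$ is $$\mathfrak{K}^{(2)}_{\varphi}(\mathbf{H},b;L)=\lim_{\epsilon\to0}\ \sup_{0<\|\mathrm{vec}(\Psi^{-1}\Delta\mathbf{H},\,\chi^{-1}\Delta b)\|_2\le\epsilon}\frac{\xi_L^{-1}\|\varphi(\mathbf{H}+\Delta\mathbf{H},b+\Delta b)-\varphi(\mathbf{H},b)\|_2}{\|\mathrm{vec}(\Psi^{-1}\Delta\mathbf{H},\,\chi^{-1}\Delta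 b)\|_2},$$ where $\Delta\mathbf{H}=(\Delta A,\Delta B,\Delta C,\Delta D,\Delta E)$ and $\Delta b\in\mathbb R^l$ are perturbations of $\mathbf{H}$ and $b$. *)

(* Defs.v *)
From HB Require Import structures.
From mathcomp Require Import all_boot all_order all_algebra.
From mathcomp Require Import all_classical all_reals all_analysis.
Set Implicit Arguments.
Unset Strict Implicit.
Unset Printing Implicit Defensive.
Import Order.TTheory GRing.Theory Num.Theory.
Import numFieldNormedType.Exports.
Local Open Scope classical_set_scope.
Local Open Scope ring_scope.

(* The norm instance that MathComp-Analysis puts on matrices is the max norm,
   so the Euclidean and spectral norms are defined separately. *)
Definition norm2 (R : realType) (n : nat) (v : 'cV[R]_n) : R :=
  Num.sqrt (\sum_(i < n) v i 0 ^+ 2).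

Definition spectral_norm (R : realType) (m n : nat) (M : 'M[R]_(m, n)) : R :=
  sup [set norm2 (M *m v) | v in [set v : 'cV[R]_n | norm2 v <= 1]].

(* [mxvec] concatenates rows, hence the transposition to stack columns. *)
Definition vec (R : realType) (m n : nat) (M : 'M[R]_(m, n)) : 'cV[R]_(n * m) :=
  (mxvec M^T)^T.

(* The tuple (A, B, C, D, E), with the componentwise addition and scaling that
   the library puts on products. *)
Definition blocks (R : realType) (n m p : nat) : Type :=
  ('M[R]_(n, n) * 'M[R]_(m, n) * 'M[R]_(p, m) * 'M[R]_(m, m) * 'M[R]_(p, p))%type.

Definition vec_data (R : realType) (n m p : nat) (H : blocks R n m p)
    (b : 'cV[R]_(n + m + p)) :=
  let: (A, B, C, D, E) := H in
  col_mx (vec A) (col_mx (vec B) (col_mx (vec C) (col_mx (vec D)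
    (col_mx (vec E) (vec b))))).

Definition saddle_mx (R : realType) (n m p : nat) (H : blocks R n m p) :
    'M[R]_(n + m + p) :=
  let: (A, B, C, D, E) := H in
  block_mx (block_mx A B^T B (- D)) (col_mx 0 C^T)
           (row_mx 0 C)             E.

(* [invmx M = M] when [M] is singular, but for nonsingular [saddle_mx H] all
   small enough perturbations are nonsingular, so the limit defining
   [cond_number] never sees this value. *)
Definition phi (R : realType) (n m p k : nat) (L : 'M[R]_(k, n + m + p))
    (H : blocks R n m p) (b : 'cV[R]_(n + m + p)) : 'cV[R]_k :=
  L *m invmx (saddle_mx H) *m b.

Definition pert_norm (R : realType) (n m p : nat) (Psi chi : R)
    (dH : blocks R n m p) (db : 'cV[R]_(n + m + p)) : R :=
  norm2 (vec_data (Psi^-1 *: dH) (chi^-1 *: db)).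

Definition pert_sup (R : realType) (n m p k : nat)
    (L : 'M[R]_(k, n + m + p)) (Psi chi xi : R)
    (H : blocks R n m p) (b : 'cV[R]_(n + m + p)) (eps : R) : \bar R :=
  ereal_sup
    [set (xi^-1 * norm2 (phi L (H + d.1) (b + d.2) - phi L H b)
            / pert_norm Psi chi d.1 d.2)%:E
    | d in [set d : blocks R n m p * 'cV[R]_(n + m + p)
           | 0 < pert_norm Psi chi d.1 d.2 <= eps]].

Definition cond_number (R : realType) (n m p k : nat)
    (L : 'M[R]_(k, n + m + p)) (Psi chi xi : R)
    (H : blocks R n m p) (b : 'cV[R]_(n + m + p)) : \bar R :=
  lim (pert_sup L Psi chi xi H b eps @[eps --> 0^'+]).

(* The limit always exists in [\bar R], as the supremum is monotone in [eps]. *)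
Lemma pert_sup_is_cvg (R : realType) (n m p k : nat)
    (L : 'M[R]_(k, n + m + p)) (Psi chi xi : R)
    (H : blocks R n m p) (b : 'cV[R]_(n + m + p)) :
  cvg (pert_sup L Psi chi xi H b eps @[eps --> 0^'+]).
Proof.
apply: nondecreasing_at_right_is_cvge; apply: nearW => e s t _ _ st.
apply: ereal_sup_le => _ [d /= /andP[d0 ds] <-].
by exists d => //=; rewrite d0 (le_trans ds st).
Qed.

Definition Jmx (R : realType) (n m p : nat)
    (x : 'cV[R]_n) (y : 'cV[R]_m) (z : 'cV[R]_p) : 'M[R]_(n + m + p) :=
  block_mx
    (block_mx (norm2 x ^+ 2 + norm2 y ^+ 2)%:M (x *m y^T)
              (y *m x^T) (norm2 x ^+ 2 + norm2 y ^+ 2 + norm2 z ^+ 2)%:M)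
    (col_mx 0 (y *m z^T))
    (row_mx 0 (z *m y^T))
    (norm2 y ^+ 2 + norm2 z ^+ 2)%:M.

Definition cond_upper (R : realType) (n m p k : nat)
    (L : 'M[R]_(k, n + m + p)) (Psi chi xi : R) (H : blocks R n m p)
    (x : 'cV[R]_n) (y : 'cV[R]_m) (z : 'cV[R]_p) : R :=
  spectral_norm (L *m invmx (saddle_mx H)) / xi
    * (Psi * Num.sqrt (spectral_norm (Jmx x y z)) + chi).

(* Main.v *)
Require Import Defs.
From mathcomp Require Import all_boot all_order all_algebra.
From mathcomp Require Import all_classical all_reals all_analysis.
From mathcomp Require Import ring lra.
Import Order.TTheory GRing.Theory Num.Theory.
Import numFieldNormedType.Exports.
Local Open Scope ring_scope.

(** Let [M = saddle_mx H], [dM = saddle_mx dH], let [w] and [w'] solve the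
    original and the perturbed system, and put [d = w' - w].  Subtracting the
    two systems gives [M d = db - dM w - dM d], so that
    [L d = (L M^-1) (db - dM w - dM d)].  The bound follows by estimating the
    three terms against the size [q] of the perturbation.

    - [|db| <= chi q], directly from the definition of [q].
    - [|dM w| <= Psi |J|^(1/2) q].  For fixed [w] the map [G : dH |-> dM w] is
      linear, and [J = G G^T]; hence [|G^T u|^2 = u^T J u <= |J| |u|^2], and
      Cauchy-Schwarz applied to [u^T G dH] with [u = G dH] gives
      [|G dH| <= |J|^(1/2) |dH|].  The adjoint [G^T] is [saddle_adj]
      ([saddle_adjP]), its Gram matrix is computed in [saddle_adj_Jmx], and the
      estimate is [norm2_saddle_Jmx].
    - [|dM d| <= 2 Psi q |d|], and [|d| = O(q)] once [q] is so small that
      [dM d] can be absorbed on the left ([perturbed_solution]); the same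
      smallness makes the perturbed matrix invertible ([perturbed_unit]).

    Hence each difference quotient is at most the claimed bound plus a fixed
    multiple of [q] ([phi_pert_bound]), and the excess disappears as the radius
    of the perturbations tends to 0. *)

Set Implicit Arguments.
Unset Strict Implicit.

(** * The Frobenius inner product *)

Definition fdot (R : realType) (m n : nat) (X Y : 'M[R]_(m, n)) : R :=
  \tr (X^T *m Y).

Lemma fdotC (R : realType) (m n : nat) (X Y : 'M[R]_(m, n)) :
  fdot X Y = fdot Y X.
Proof. by rewrite /fdot -mxtrace_tr trmx_mul trmxK. Qed.

Lemma fdotDl (R : realType) (m n : nat) (X Y Z : 'M[R]_(m, n)) :
  fdot (X + Y) Z = fdot X Z + fdot Y Z.
Proof. by rewrite /fdot linearD mulmxDl linearD. Qed.

Lemma fdotZl (R : realType) (m n : nat) (a : R) (X Y : 'M[R]_(m, n)) :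
  fdot (a *: X) Y = a * fdot X Y.
Proof. by rewrite /fdot linearZ -scalemxAl linearZ. Qed.

Lemma fdotNl (R : realType) (m n : nat) (X Y : 'M[R]_(m, n)) :
  fdot (- X) Y = - fdot X Y.
Proof. by rewrite -scaleN1r fdotZl mulN1r. Qed.

Lemma fdotDr (R : realType) (m n : nat) (X Y Z : 'M[R]_(m, n)) :
  fdot Z (X + Y) = fdot Z X + fdot Z Y.
Proof. by rewrite fdotC fdotDl !(fdotC Z). Qed.

Lemma fdotZr (R : realType) (m n : nat) (a : R) (X Y : 'M[R]_(m, n)) :
  fdot X (a *: Y) = a * fdot X Y.
Proof. by rewrite fdotC fdotZl fdotC. Qed.

Lemma fdotNr (R : realType) (m n : nat) (X Y : 'M[R]_(m, n)) :
  fdot X (- Y) = - fdot X Y.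
Proof. by rewrite fdotC fdotNl fdotC. Qed.

Lemma fdot0r (R : realType) (m n : nat) (X : 'M[R]_(m, n)) :
  fdot X 0 = 0.
Proof. by rewrite /fdot mulmx0 mxtrace0. Qed.

Lemma fdotE (R : realType) (m n : nat) (X Y : 'M[R]_(m, n)) :
  fdot X Y = \sum_i \sum_j X i j * Y i j.
Proof.
rewrite exchange_big; apply: eq_bigr => j _.
by rewrite mxE; apply: eq_bigr => i _; rewrite mxE.
Qed.

Lemma fdot_tr (R : realType) (m n : nat) (X Y : 'M[R]_(m, n)) :
  fdot X^T Y^T = fdot X Y.
Proof. by rewrite /fdot -mxtrace_tr trmx_mul !trmxK mxtrace_mulC. Qed.

Lemma fdot_vec (R : realType) (m n : nat) (X Y : 'M[R]_(m, n)) :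
  fdot (vec X) (vec Y) = fdot X Y.
Proof.
rewrite fdot_tr -(fdot_tr X Y) !fdotE big_ord1 pair_big /=.
rewrite (reindex _ (curry_mxvec_bij _ _)) /=.
by apply: eq_bigr => -[i j] _; rewrite !mxvecE.
Qed.

Lemma fdot_col_mx (R : realType) (m1 m2 n : nat)
    (X1 Y1 : 'M[R]_(m1, n)) (X2 Y2 : 'M[R]_(m2, n)) :
  fdot (col_mx X1 X2) (col_mx Y1 Y2) = fdot X1 Y1 + fdot X2 Y2.
Proof. by rewrite /fdot tr_col_mx mul_row_col linearD. Qed.

Lemma fdot_row_mx (R : realType) (m n1 n2 : nat)
    (X1 Y1 : 'M[R]_(m, n1)) (X2 Y2 : 'M[R]_(m, n2)) :
  fdot (row_mx X1 X2) (row_mx Y1 Y2) = fdot X1 Y1 + fdot X2 Y2.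
Proof. by rewrite -fdot_tr !tr_row_mx fdot_col_mx !fdot_tr. Qed.

(** For fixed [v] the linear map [X |-> X v] has adjoint [u |-> u v^T]; together
    with its transposed variant this gives the adjoint of a block matrix one
    block at a time. *)
Lemma fdot_mulr (R : realType) (m n : nat)
    (u : 'cV[R]_m) (X : 'M[R]_(m, n)) (v : 'cV[R]_n) :
  fdot u (X *m v) = fdot (u *m v^T) X.
Proof. by rewrite /fdot trmx_mul trmxK -mulmxA (mxtrace_mulC v) mulmxA. Qed.

Lemma fdot_trmulr (R : realType) (m n : nat)
    (u : 'cV[R]_m) (X : 'M[R]_(n, m)) (v : 'cV[R]_n) :
  fdot u (X^T *m v) = fdot (v *m u^T) X.
Proof. by rewrite fdot_mulr -fdot_tr trmx_mul !trmxK. Qed.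

Lemma fdot_outer (R : realType) (m n : nat) (u s : 'cV[R]_m) (v t : 'cV[R]_n) :
  fdot (u *m v^T) (s *m t^T) = fdot u s * fdot v t.
Proof.
rewrite !fdotE mulr_suml; apply: eq_bigr => i _; rewrite big_ord1 mulr_sumr.
by apply: eq_bigr => j _; rewrite !mxE !big_ord1 !mxE mulrACA.
Qed.

(** * Euclidean and spectral norms *)

Lemma norm2_ge0 (R : realType) (n : nat) (v : 'cV[R]_n) : 0 <= norm2 v.
Proof. exact: sqrtr_ge0. Qed.

Lemma sqr_norm2 (R : realType) (n : nat) (v : 'cV[R]_n) :
  norm2 v ^+ 2 = fdot v v.
Proof.
rewrite sqr_sqrtr ?sumr_ge0// => [|i _]; last exact: sqr_ge0.
by rewrite fdotE; apply: eq_bigr => i _; rewrite big_ord1.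
Qed.

Lemma fdot_ge0 (R : realType) (m n : nat) (X : 'M[R]_(m, n)) : 0 <= fdot X X.
Proof. by rewrite -fdot_vec -sqr_norm2 sqr_ge0. Qed.

Lemma norm2_eq0 (R : realType) (n : nat) (v : 'cV[R]_n) : norm2 v = 0 -> v = 0.
Proof.
move=> /eqP; rewrite -sqrf_eq0 sqr_norm2 fdotE psumr_eq0; last first.
  by move=> i _; rewrite big_ord1 -expr2 sqr_ge0.
move=> /allP v0; apply/colP => i; rewrite mxE.
have := v0 i (mem_index_enum i); rewrite big_ord1 -expr2 sqrf_eq0.
by move=> /eqP.
Qed.

Lemma norm2_le (R : realType) (n : nat) (v : 'cV[R]_n) (c : R) :
  0 <= c -> fdot v v <= c ^+ 2 -> norm2 v <= c.
Proof. by move=> c0; rewrite -sqr_norm2 ler_pXn2r ?nnegrE ?norm2_ge0. Qed.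

Lemma norm2Z (R : realType) (n : nat) (a : R) (v : 'cV[R]_n) :
  norm2 (a *: v) = `|a| * norm2 v.
Proof.
apply/eqP; rewrite -(@eqrXn2 _ 2) ?mulr_ge0 ?norm2_ge0//.
by rewrite exprMn !sqr_norm2 fdotZl fdotZr real_normK ?num_real// mulrA.
Qed.

Lemma norm2N (R : realType) (n : nat) (v : 'cV[R]_n) : norm2 (- v) = norm2 v.
Proof. by rewrite -scaleN1r norm2Z normrN1 mul1r. Qed.

Lemma norm20 (R : realType) (n : nat) : norm2 (0 : 'cV[R]_n) = 0.
Proof. by rewrite -[X in norm2 X](scale0r 0) norm2Z normr0 mul0r. Qed.

Lemma cauchy_schwarz (R : realType) (n : nat) (u v : 'cV[R]_n) :
  fdot u v <= norm2 u * norm2 v.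
Proof.
have [u0|u0] := eqVneq (norm2 u) 0.
  by rewrite u0 mul0r (norm2_eq0 u0) fdotC fdot0r.
have [v0|v0] := eqVneq (norm2 v) 0.
  by rewrite v0 mulr0 (norm2_eq0 v0) fdot0r.
have uv0 : 0 < norm2 u * norm2 v by rewrite mulr_gt0// lt0r norm2_ge0 ?u0 ?v0.
have := fdot_ge0 (norm2 v *: u - norm2 u *: v).
rewrite !(fdotDl, fdotDr, fdotNl, fdotNr, fdotZl, fdotZr) -!sqr_norm2 (fdotC v).
move: (fdot u v) (norm2 u) (norm2 v) uv0 => c a e ae0 h.
rewrite -(ler_pM2l ae0); nra.
Qed.

Lemma norm2D (R : realType) (n : nat) (u v : 'cV[R]_n) :
  norm2 (u + v) <= norm2 u + norm2 v.
Proof.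
apply: norm2_le; first by rewrite addr_ge0 ?norm2_ge0.
rewrite !(fdotDl, fdotDr) (fdotC v) -!sqr_norm2.
have := cauchy_schwarz u v; nra.
Qed.

(** The form in which duality is used: when [t = M v], the left-hand side pairs
    [t] with [M v], so that adjunction and Cauchy-Schwarz bound it by a multiple
    of [norm2 t], and one factor [norm2 t] cancels. *)
Lemma norm2_dual (R : realType) (n : nat) (t : 'cV[R]_n) (c : R) :
  0 <= c -> fdot t t <= c * norm2 t -> norm2 t <= c.
Proof.
rewrite -sqr_norm2 => c0; have [->//|t0] := eqVneq (norm2 t) 0.
by rewrite expr2 ler_pM2r// lt0r t0 norm2_ge0.
Qed.

(** The spectral norm is a supremum, so some a priori bound on the image of the
    unit ball is needed for it to dominate anything; the Frobenius norm gives
    one. *)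
Lemma norm2_mulmx_frob (R : realType) (m n : nat)
    (M : 'M[R]_(m, n)) (v : 'cV[R]_n) :
  norm2 (M *m v) <= norm2 (vec M) * norm2 v.
Proof.
apply: norm2_dual; first by rewrite mulr_ge0 ?norm2_ge0.
set u := {1 3}(M *m v); rewrite fdot_mulr -fdot_vec.
apply: le_trans (cauchy_schwarz _ _) _.
rewrite mulrC -mulrA ler_wpM2l ?norm2_ge0// norm2_le ?mulr_ge0 ?norm2_ge0//.
by rewrite fdot_vec fdot_outer exprMn !sqr_norm2 mulrC.
Qed.

Lemma norm2_image_ub (R : realType) (m n : nat) (M : 'M[R]_(m, n)) :
  has_ubound
    [set norm2 (M *m v) | v in [set v : 'cV[R]_n | norm2 v <= 1]]%classic.
Proof.
exists (norm2 (vec M)) => _ [s /= s1 <-].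
apply: le_trans (norm2_mulmx_frob _ _) _.
by rewrite ler_piMr ?norm2_ge0.
Qed.

Lemma norm2_mulmx (R : realType) (m n : nat)
    (M : 'M[R]_(m, n)) (v : 'cV[R]_n) :
  norm2 (M *m v) <= spectral_norm M * norm2 v.
Proof.
have [v0|v0] := eqVneq (norm2 v) 0.
  by rewrite v0 mulr0 (norm2_eq0 v0) mulmx0 norm20.
have v_gt0 : 0 < norm2 v by rewrite lt0r v0 norm2_ge0.
rewrite -ler_pdivrMr// mulrC -[X in X * _]ger0_norm ?invr_ge0 ?norm2_ge0//.
rewrite -norm2Z scalemxAr; apply: ub_le_sup; last first.
  exists ((norm2 v)^-1 *: v) => //=.
  by rewrite norm2Z ger0_norm ?invr_ge0 ?norm2_ge0// mulVf.
exact: norm2_image_ub.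
Qed.

Lemma spectral_norm_ge0 (R : realType) (m n : nat) (M : 'M[R]_(m, n)) :
  0 <= spectral_norm M.
Proof.
apply: le_trans (norm2_ge0 (M *m 0)) _; apply: ub_le_sup; last first.
  by exists 0 => //=; rewrite norm20.
exact: norm2_image_ub.
Qed.

(** * Perturbation of a linear system *)

Lemma unitmx_inj (R : realType) (n : nat) (M : 'M[R]_n) :
  (forall v : 'cV[R]_n, M *m v = 0 -> v = 0) -> M \in unitmx.
Proof.
move=> Minj; rewrite -unitmx_tr -row_free_unit -kermx_eq0; apply/eqP/row_matrixP => i.
rewrite row0; apply: trmx_inj; rewrite trmx0; apply: Minj.
by apply: trmx_inj; rewrite trmx_mul trmxK -row_mul mulmx_ker row0 trmx0.
Qed.

(** A kernel vector [v] of [M + dM] satisfies [v = - M^-1 (dM v)], and the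
    smallness of [dM] then forces [|v| <= |v| / 2]. *)
Lemma perturbed_unit (R : realType) (l : nat) (M dM : 'M[R]_l) (c : R) :
  M \in unitmx -> (forall v, norm2 (dM *m v) <= c * norm2 v) ->
  spectral_norm (invmx M) * c <= 2^-1 -> M + dM \in unitmx.
Proof.
move=> uM dMc rc; apply: unitmx_inj => v; rewrite mulmxDl => /eqP.
rewrite addr_eq0 => /eqP Mv; apply: norm2_eq0; apply/eqP.
have : norm2 v <= 2^-1 * norm2 v.
  rewrite -{1}(mulKmx uM v) Mv.
  apply: le_trans (norm2_mulmx _ _) _; rewrite norm2N.
  apply: le_trans (ler_wpM2l (spectral_norm_ge0 _) (dMc v)) _.
  by rewrite mulrA ler_wpM2r ?norm2_ge0.
have := norm2_ge0 v; lra.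
Qed.

(** The identity is left implicit in [w' - w]: the terms [db - dM *m w] then
    carry the exact constants of the final bound, and the remaining one is of
    second order.  The crude estimate of [w' - w] serves only to see this; it
    comes from absorbing the last term, at the price of the factor 2. *)
Lemma perturbed_solution (R : realType) (l : nat) (M dM : 'M[R]_l)
    (w w' b db : 'cV[R]_l) (c : R) :
  M \in unitmx -> (forall v, norm2 (dM *m v) <= c * norm2 v) ->
  spectral_norm (invmx M) * c <= 2^-1 ->
  M *m w = b -> (M + dM) *m w' = b + db ->
  [/\ w' - w = invmx M *m (db - dM *m w - dM *m (w' - w))
    & norm2 (w' - w)
      <= 2 * spectral_norm (invmx M) * (norm2 db + norm2 (dM *m w))].
Proof.
move=> uM dMc rc Mw Mw'.
have eqd : w' - w = invmx M *m (db - dM *m w - dM *m (w' - w)).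
  apply: (can_inj (mulKmx uM)); rewrite mulKVmx// !mulmxBr Mw.
  have -> : M *m w' = b + db - dM *m w' by rewrite -Mw' mulmxDl addrK.
  by rewrite opprB addrACA; apply/matrixP => i j; rewrite !mxE; ring.
split=> //.
have : norm2 (w' - w) <= spectral_norm (invmx M) * (norm2 db + norm2 (dM *m w))
    + 2^-1 * norm2 (w' - w).
  rewrite {1}eqd; apply: le_trans (norm2_mulmx _ _) _.
  have r0 := spectral_norm_ge0 (invmx M).
  apply: (@le_trans _ _ (spectral_norm (invmx M)
     * (norm2 db + norm2 (dM *m w) + c * norm2 (w' - w)))).
    rewrite ler_wpM2l//.
    apply: le_trans (norm2D _ _) _; rewrite norm2N lerD//.
    by apply: le_trans (norm2D _ _) _; rewrite norm2N.
  by rewrite mulrDr lerD2l mulrA ler_wpM2r ?norm2_ge0.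
lra.
Qed.

(** * Size of the perturbation of a saddle point matrix *)

Lemma saddle_mxD (R : realType) (n m p : nat) (H K : blocks R n m p) :
  saddle_mx (H + K) = saddle_mx H + saddle_mx K.
Proof.
case: H K => [[[[A B] C] D] E] [[[[A' B'] C'] D'] E'] /=.
by rewrite !add_block_mx add_col_mx add_row_mx !linearD !addr0.
Qed.

Lemma fdot_vec_data (R : realType) (n m p : nat)
    (A A' : 'M[R]_(n, n)) (B B' : 'M[R]_(m, n)) (C C' : 'M[R]_(p, m))
    (D D' : 'M[R]_(m, m)) (E E' : 'M[R]_(p, p)) (b b' : 'cV[R]_(n + m + p)) :
  fdot (vec_data (A, B, C, D, E) b) (vec_data (A', B', C', D', E') b')
  = fdot A A' + fdot B B' + fdot C C' + fdot D D' + fdot E E' + fdot b b'.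
Proof. by rewrite !fdot_col_mx !fdot_vec !addrA. Qed.

Lemma sqr_pert_norm (R : realType) (n m p : nat) (Psi chi : R)
    (dH : blocks R n m p) (db : 'cV[R]_(n + m + p)) :
  pert_norm Psi chi dH db ^+ 2
  = Psi^-1 ^+ 2 * norm2 (vec_data dH 0) ^+ 2 + chi^-1 ^+ 2 * norm2 db ^+ 2.
Proof.
case: dH => [[[[A B] C] D] E]; rewrite /pert_norm.
rewrite (_ : Psi^-1 *: _ =
  (Psi^-1 *: A, Psi^-1 *: B, Psi^-1 *: C, Psi^-1 *: D, Psi^-1 *: E))//.
move: Psi^-1 chi^-1 => a c.
rewrite !sqr_norm2 !fdot_vec_data !fdotZl !fdotZr fdot0r; ring.
Qed.

Lemma norm2_data_le (R : realType) (n m p : nat) (Psi chi : R)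
    (dH : blocks R n m p) (db : 'cV[R]_(n + m + p)) :
  0 < Psi -> norm2 (vec_data dH 0) <= Psi * pert_norm Psi chi dH db.
Proof.
move=> Psi0; rewrite -ler_pdivrMl// -(@ler_pXn2r _ 2) ?nnegrE//; last 2 first.
- by rewrite mulr_ge0 ?norm2_ge0// invr_ge0 ltW.
- exact: norm2_ge0.
by rewrite sqr_pert_norm exprMn lerDl mulr_ge0 ?sqr_ge0.
Qed.

Lemma norm2_rhs_le (R : realType) (n m p : nat) (Psi chi : R)
    (dH : blocks R n m p) (db : 'cV[R]_(n + m + p)) :
  0 < chi -> norm2 db <= chi * pert_norm Psi chi dH db.
Proof.
move=> chi0; rewrite -ler_pdivrMl// -(@ler_pXn2r _ 2) ?nnegrE//; last 2 first.
- by rewrite mulr_ge0 ?norm2_ge0// invr_ge0 ltW.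
- exact: norm2_ge0.
by rewrite sqr_pert_norm exprMn lerDr mulr_ge0 ?sqr_ge0.
Qed.

(** Each of [B] and [C] appears twice in the saddle point matrix, so the squared
    norms compare with the factor 2; the constant matters only in a second order
    term and is rounded up to avoid a square root. *)
Lemma norm2_saddle_frob (R : realType) (n m p : nat) (H : blocks R n m p) :
  norm2 (vec (saddle_mx H)) <= 2 * norm2 (vec_data H 0).
Proof.
apply: norm2_le; first by rewrite mulr_ge0 ?norm2_ge0.
case: H => [[[[A B] C] D] E]; rewrite exprMn sqr_norm2 fdot_vec_data fdot_vec /=.
rewrite !(fdot_row_mx, fdot_col_mx, fdot_tr, fdotNl, fdotNr, fdot0r).
have := (fdot_ge0 A, fdot_ge0 B, fdot_ge0 C, fdot_ge0 D, fdot_ge0 E).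
move=> [[[[]]]]; lra.
Qed.

Lemma norm2_saddle_mul (R : realType) (n m p : nat) (H : blocks R n m p)
    (v : 'cV[R]_(n + m + p)) :
  norm2 (saddle_mx H *m v) <= 2 * norm2 (vec_data H 0) * norm2 v.
Proof.
apply: le_trans (norm2_mulmx_frob _ _) _.
by rewrite ler_wpM2r ?norm2_ge0 ?norm2_saddle_frob.
Qed.

(** The adjoint, for the Frobenius inner products, of the linear map
    [H |-> saddle_mx H *m w] with [w = (x, y, z)], applied to
    [u = (u1, u2, u3)].  [B] and [C] receive two terms each because they act on
    [w] both directly and through their transposes. *)
Definition saddle_adj (R : realType) (n m p : nat)
    (x u1 : 'cV[R]_n) (y u2 : 'cV[R]_m) (z u3 : 'cV[R]_p) : blocks R n m p :=
  (u1 *m x^T, y *m u1^T + u2 *m x^T, z *m u2^T + u3 *m y^T,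
   - (u2 *m y^T), u3 *m z^T).

Lemma saddle_adjP (R : realType) (n m p : nat) (H : blocks R n m p)
    (x u1 : 'cV[R]_n) (y u2 : 'cV[R]_m) (z u3 : 'cV[R]_p) :
  fdot (col_mx (col_mx u1 u2) u3) (saddle_mx H *m col_mx (col_mx x y) z)
  = fdot (vec_data (saddle_adj x u1 y u2 z u3) 0) (vec_data H 0).
Proof.
case: H => [[[[A B] C] D] E]; rewrite fdot_vec_data /=.
rewrite !mul_block_col mul_col_mx mul_row_col !mul0mx add_col_mx !fdot_col_mx.
rewrite addr0 add0r !(fdotDr, fdotDl) mulNmx fdotNr fdotNl fdot0r !fdot_trmulr !fdot_mulr.
ring.
Qed.

(** This is where [Jmx] comes from: it is the Gram matrix [G G^T] of the map
    [G : H |-> saddle_mx H *m w].  Its off-diagonal blocks are the cross terms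
    in the squared norms of the [B] and [C] components of the adjoint. *)
Lemma saddle_adj_Jmx (R : realType) (n m p : nat)
    (x u1 : 'cV[R]_n) (y u2 : 'cV[R]_m) (z u3 : 'cV[R]_p) :
  let u := col_mx (col_mx u1 u2) u3 in
  norm2 (vec_data (saddle_adj x u1 y u2 z u3) 0) ^+ 2
  = fdot u (Jmx x y z *m u).
Proof.
rewrite /= sqr_norm2 fdot_vec_data /Jmx !sqr_norm2.
rewrite !mul_block_col mul_col_mx mul_row_col !mul0mx add_col_mx !fdot_col_mx.
rewrite addr0 add0r !mul_scalar_mx.
rewrite !(fdotDr, fdotDl, fdotNl, fdotNr, fdotZr, fdot0r) !fdot_mulr !fdot_outer.
rewrite (fdotC u1 x) (fdotC u2 y) (fdotC u3 z).
ring.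
Qed.

(** The first order effect of the perturbation: [|G| <= |G G^T|^(1/2)], proved
    by duality since [fdot u (Jmx x y z *m u)] is at most
    [spectral_norm (Jmx x y z) * norm2 u ^+ 2]. *)
Lemma norm2_saddle_Jmx (R : realType) (n m p : nat) (H : blocks R n m p)
    (x : 'cV[R]_n) (y : 'cV[R]_m) (z : 'cV[R]_p) :
  norm2 (saddle_mx H *m col_mx (col_mx x y) z)
  <= Num.sqrt (spectral_norm (Jmx x y z)) * norm2 (vec_data H 0).
Proof.
set t := saddle_mx H *m _; set S := spectral_norm _.
have S0 : 0 <= S by exact: spectral_norm_ge0.
apply: norm2_dual; first by rewrite mulr_ge0 ?norm2_ge0 ?sqrtr_ge0.
set u := {1 3}t; rewrite /t -(vsubmxK u) -(vsubmxK (usubmx u)) saddle_adjP.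
apply: le_trans (cauchy_schwarz _ _) _.
rewrite [leRHS]mulrAC ler_wpM2r ?norm2_ge0//.
apply: norm2_le; first by rewrite mulr_ge0 ?norm2_ge0 ?sqrtr_ge0.
rewrite -sqr_norm2 saddle_adj_Jmx !vsubmxK exprMn sqr_sqrtr//.
apply: le_trans (cauchy_schwarz _ _) _.
by rewrite mulrC expr2 mulrA ler_wpM2r ?norm2_ge0 ?norm2_mulmx.
Qed.

(** * The condition number bound *)

(** [T * q] bounds the first order residual [db - dM w]; the term in [q ^ 2]
    comes from [dM (w' - w)], with [|dM| <= 2 Psi q] and [|w' - w| <= 2 r T q].
    The smallness hypothesis is the one that makes the perturbed system
    solvable. *)
Lemma phi_pert_bound (R : realType) (n m p k : nat) (H dH : blocks R n m p)
    (b db : 'cV[R]_(n + m + p)) (L : 'M[R]_(k, n + m + p)) (Psi chi : R)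
    (x : 'cV[R]_n) (y : 'cV[R]_m) (z : 'cV[R]_p) :
  let r := spectral_norm (invmx (saddle_mx H)) in
  let q := pert_norm Psi chi dH db in
  let T := Psi * Num.sqrt (spectral_norm (Jmx x y z)) + chi in
  saddle_mx H \in unitmx -> saddle_mx H *m col_mx (col_mx x y) z = b ->
  0 < Psi -> 0 < chi -> r * (2 * Psi * q) <= 2^-1 ->
  norm2 (phi L (H + dH) (b + db) - phi L H b)
  <= spectral_norm (L *m invmx (saddle_mx H)) * (T + 4 * r * Psi * T * q) * q.
Proof.
move=> r q T; set w := col_mx _ z; set S := Num.sqrt _ in T *.
set M := saddle_mx H in r * => uM Mw Psi0 chi0 rq.
have q0 : 0 <= q by exact: norm2_ge0.
have hH : norm2 (vec_data dH 0) <= Psi * q by exact: norm2_data_le.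
have dMc v : norm2 (saddle_mx dH *m v) <= 2 * Psi * q * norm2 v.
  apply: le_trans (norm2_saddle_mul _ _) _.
  by rewrite ler_wpM2r ?norm2_ge0// -mulrA ler_wpM2l.
have uM' := perturbed_unit uM dMc rq.
pose w' := invmx (M + saddle_mx dH) *m (b + db).
have Mw' : (M + saddle_mx dH) *m w' = b + db by rewrite mulKVmx.
have [eqd led] := perturbed_solution uM dMc rq Mw Mw'.
have first : norm2 db + norm2 (saddle_mx dH *m w) <= T * q.
  rewrite mulrDl [leRHS]addrC; apply: lerD; first exact: norm2_rhs_le.
  apply: le_trans (norm2_saddle_Jmx _ _ _ _) _.
  by rewrite -/S mulrAC [leRHS]mulrC ler_wpM2l ?sqrtr_ge0.
have -> : phi L (H + dH) (b + db) - phi L H b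
    = (L *m invmx M) *m (db - saddle_mx dH *m w - saddle_mx dH *m (w' - w)).
  by rewrite -mulmxA -eqd mulmxBr /phi saddle_mxD -!mulmxA -/M -{2}Mw mulKmx.
apply: le_trans (norm2_mulmx _ _) _.
rewrite -mulrA ler_wpM2l ?spectral_norm_ge0// mulrDl.
apply: le_trans (norm2D _ _) _; rewrite norm2N lerD//.
  by apply: le_trans (norm2D _ _) _; rewrite norm2N.
apply: le_trans (dMc _) _.
have -> : 4 * r * Psi * T * q * q = 2 * Psi * q * (2 * r * (T * q)) by ring.
rewrite ler_wpM2l ?mulr_ge0 ?(ltW Psi0)//.
by apply: le_trans led _; rewrite ler_wpM2l// mulr_ge0 ?spectral_norm_ge0.
Qed.

Unset Implicit Arguments.
Set Strict Implicit.

Theorem corollary3p1 (R : realType) (n m p k : nat)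
    (A : 'M[R]_(n, n)) (B : 'M[R]_(m, n)) (C : 'M[R]_(p, m))
    (D : 'M[R]_(m, m)) (E : 'M[R]_(p, p)) (b : 'cV[R]_(n + m + p))
    (L : 'M[R]_(k, n + m + p)) (Psi chi xi : R)
    (x : 'cV[R]_n) (y : 'cV[R]_m) (z : 'cV[R]_p)
    (hB : saddle_mx (A, B, C, D, E) \in unitmx)
    (hw : saddle_mx (A, B, C, D, E) *m col_mx (col_mx x y) z = b)
    (hk : (k <= n + m + p)%N)
    (hPsi : 0 < Psi) (hchi : 0 < chi) (hxi : 0 < xi) :
  (cond_number L Psi chi xi (A, B, C, D, E) b
     <= (cond_upper L Psi chi xi (A, B, C, D, E) x y z)%:E)%E.
Proof.
rewrite /cond_upper; set H : blocks R n m p := (A, B, C, D, E).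
set T := _ + chi; set N := spectral_norm _.
pose r := spectral_norm (invmx (saddle_mx H)).
have r0 : 0 <= r by exact: spectral_norm_ge0.
have Nxi0 : 0 <= N / xi by rewrite divr_ge0 ?spectral_norm_ge0// ltW.
have T0 : 0 <= T by rewrite addr_ge0 ?mulr_ge0 ?sqrtr_ge0 ?ltW.
pose K := 4 * r * Psi * T.
have K0 : 0 <= K by rewrite !mulr_ge0 ?(ltW hPsi).
apply/lee_addgt0Pr => e e0.
(* Perturbations of size at most [a] meet the smallness requirement; the [+ 1]
   keeps the denominator positive when the data degenerate. *)
pose a := 2^-1 / (r * (2 * Psi) + 1).
have d1 : 0 < r * (2 * Psi) + 1 by rewrite ltr_wpDl// !mulr_ge0// ltW.
have a0 : 0 < a by rewrite divr_gt0.
have d2 : 0 < N / xi * K + 1 by rewrite ltr_wpDl// mulr_ge0.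
(* For perturbations of size at most [c] the second order term is below [e]. *)
pose c := e / (N / xi * K + 1).
have c0 : 0 < c by rewrite divr_gt0.
apply: lime_le; first exact: pert_sup_is_cvg.
near=> eps.
have epsa : eps <= a by near: eps; exact: nbhs_right_le.
have epsc : eps <= c by near: eps; exact: nbhs_right_le.
apply: ge_ereal_sup => _ [[dH db] /= /andP[q0 qe] <-].
rewrite -EFinD lee_fin ler_pdivrMr//.
set q := pert_norm _ _ _ _ in q0 qe *.
have rq : r * (2 * Psi * q) <= 2^-1.
  have : q <= a by exact: le_trans qe epsa.
  by rewrite ler_pdivlMr//; nra.
have := @phi_pert_bound _ _ _ _ _ H dH b db L Psi chi x y z hB hw hPsi hchi rq.
rewrite -/T -/N -/q -/r -/K => bnd.
apply: le_trans (ler_wpM2l _ bnd) _; first by rewrite invr_ge0 ltW.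
have -> : xi^-1 * (N * (T + K * q) * q) = (N / xi * T + N / xi * K * q) * q by ring.
rewrite ler_pM2r// lerD2l.
have : q <= c by exact: le_trans qe epsc.
by rewrite ler_pdivlMr//; nra.
Unshelve. all: by end_near.
Qed.
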